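(* Let $\mathcal{A}$ be an associative algebra with unit $I$, and let $w_n,\tilde w_n$ ($n\ge 1$) be $\mathcal{A}$-valued differentiable functions of $\mathbf{t}_o=(t_1,t_3,t_5,\ldots)$. Put $w(\mathbf{t}_o,z)=I+\sum_{n\ge1}w_n(\mathbf{t}_o)z^{-n}$, $\tilde w(\mathbf{t}_o,z)=I+\sum_{n\ge1}\tilde w_n(\mathbf{t}_o)z^{-n}$, $\tilde\xi(\mathbf{t}_o,z)=\sum_{n\ge1}t_{2n-1}z^{2n-1}$, $\psi(\mathbf{t}_o,z)=w(\mathbf{t}_o,z)e^{\tilde\xi(\mathbf{t}_o,z)}$, $\tilde\psi(\mathbf{t}_o,z)=\tilde w(\mathbf{t}_o,z)e^{-\tilde\xi(\mathbf{t}_o,z)}$, and suppose the bilinear identity $$\mathrm{res}_z\big[\psi(\mathbf{s}_o,z)\,\tilde\psi(\mathbf{t}_o,z)\big]=0$$ holds for all $\mathbf{s}_o,\mathbf{t}_o$. Define $\phi:=-w_1$ and $\tilde\theta$ by $w_2=-\tilde\theta+\frac12(\phi_{t_1}+\phi^2)$, and let $F(\lambda):=I-\frac{\lambda}{2}(\phi_{2[\lambda]}-\phi)$. Then, with $\psi=\psi(\mathbf{t}_o,z)$ and $z,\lambda$ indeterminates, $$\frac1\lambda F(\lambda)(\psi_{2[\lambda]}-\psi)-(\psi_{2[\lambda]}+\psi)_{t_1}=\frac{\lambda}{2}\Big(\tilde\theta_{2[\lambda]}-\tilde\theta+\frac12(\phi_{2[\lambda]}-\phi)_{t_1}-\fr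ac12[\phi,\phi_{2[\lambda]}]\Big)F(\lambda)^{-1}(\psi_{2[\lambda]}+\psi).$$
   Context: For a formal series $f(z)=\sum_n f_nz^{-n}$, $\mathrm{res}_z f$ denotes the coefficient $f_1$. Miwa shift notation: $f_{[\lambda]}(\mathbf{t}_o)=f(\mathbf{t}_o+[\lambda])$ with $[\lambda]=(\lambda,\lambda^3/3,\lambda^5/5,\ldots)$, and $f_{2[\lambda]}(\mathbf{t}_o)=f(\mathbf{t}_o+2[\lambda])$; all identities in $\lambda$ are understood as identities of formal power series. $[\,\cdot,\cdot\,]$ is the commutator, and subscript $t_1$ denotes the partial derivative with respect to $t_1$. *)

(* Defs.v *)
(* Formal-algebraic model of the setting of Theorem 3.1:
   - K : a field of characteristic 0 (numFieldType), the scalars;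
   - D : an associative K-algebra with unit, playing the role of the
     A-valued (smooth) functions of t_o = (t_1, t_3, t_5, ...);
   - d k : D -> D, the partial derivative d/dt_{2k+1} (so d 0 = d/dt_1),
     assumed to be commuting K-linear derivations.
   Formal series in lambda are coefficient sequences nat -> D; formal series
   in (lambda, z) are nat -> int -> D (coefficient of lambda^n z^m).
   Objects of the form P(z) e^{xi(t_o,z)} ("dressed") are represented by their
   prefactor P : int -> D; the factor e^{xi} is scalar and common to both
   sides of the identity. *)
From HB Require Import structures.
From mathcomp Require Import all_boot all_order all_algebra.
Set Implicit Arguments. Unset Strict Implicit. Unset Printing Implicit Defensive.
Import Order.TTheory GRing.Theory Num.Theory.
Local Open Scope ring_scope.

Section Defs.
Variables (K : numFieldType) (D : algType K).

Definition lone : nat -> D := fun n => if n == 0%N then 1 else 0.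
Definition lmul (a b : nat -> D) : nat -> D :=
  fun n => \sum_(i < n.+1) a i * b (n - i)%N.
Definition lpow (a : nat -> D) (k : nat) : nat -> D := iter k (lmul a) lone.
(* inverse of a series with constant term 1, as the geometric series
   sum_k (1 - a)^k *)
Definition linv (a : nat -> D) : nat -> D :=
  fun n => \sum_(k < n.+1) lpow (fun i => lone i - a i) k n.
Definition lamhalf (a : nat -> D) : nat -> D :=
  fun n => if n == 0%N then 0 else (2 : K)^-1 *: a n.-1.
Definition lzmul (a : nat -> D) (c : nat -> int -> D) : nat -> int -> D :=
  fun n m => \sum_(i < n.+1) a i * c (n - i)%N m.

(* ---- Miwa shift t_o -> t_o + 2[lambda] as the Taylor operator
   exp( sum_k 2 lambda^(2k+1)/(2k+1) d/dt_{2k+1} ), for any family dv of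
   derivations acting on T -> D.  sterm m n f = [lambda^n] (L^m f) where
   L = sum_k (2/(2k+1)) lambda^(2k+1) dv k. *)
Fixpoint sterm (T : Type) (dv : nat -> (T -> D) -> (T -> D))
    (m n : nat) (f : T -> D) {struct m} : T -> D :=
  match m with
  | 0%N => fun x => if n == 0%N then f x else 0
  | m'.+1 => fun x => \sum_(k < n.+1 | (2 * k + 1 <= n)%N)
      ((2 : K) / (2 * k + 1)%:R) *: dv k (sterm dv m' (n - (2 * k + 1))%N f) x
  end.
Definition miwaT (T : Type) (dv : nat -> (T -> D) -> (T -> D)) (n : nat)
    (f : T -> D) : T -> D :=
  fun x => \sum_(m < n.+1) ((m`!)%:R : K)^-1 *: sterm dv m n f x.

Variable d : nat -> D -> D.

Definition miwa (n : nat) (f : D) : D :=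
  miwaT (fun k (g : unit -> D) u => d k (g u)) n (fun _ => f) tt.
Definition dshift (f : D) (n : nat) : D :=
  miwa n f - (if n == 0%N then f else 0).

(* derivative d/dt_{2k+1} of a dressed object P(z) e^{xi(t_o,z)}:
   (d P + z^{2k+1} P) e^{xi} *)
Definition dress (k : nat) (P : int -> D) : int -> D :=
  fun m => d k (P m) + P (m - (2 * k + 1)%N%:Z).

(* prefactor of psi:  w(t_o,z) = I + sum_{n>=1} w_n z^{-n} ; Negz n = -(n+1) *)
Definition ser (w : nat -> D) : int -> D :=
  fun m => match m with
           | Posz 0%N => 1
           | Posz _ => 0
           | Negz n => w n.+1
           end.
(* coefficient of z^{-i} in tilde w *)
Definition wtser (wt : nat -> D) (i : nat) : D :=
  if i == 0%N then 1 else wt i.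

Definition weight (a : seq nat) : nat := sumn [seq (2 * k + 1)%N | k <- a].

(* Bilinear identity res_z psi(s_o,z) tilde psi(t_o,z) = 0 for all s_o, t_o,
   in its Taylor-expanded form at s_o = t_o + y: for every multi-index
   (list of derivations) a, res_z [ (d^a psi)(t_o,z) tilde psi(t_o,z) ] = 0.
   (d^a psi) has prefactor foldr dress (ser w) a, whose z-degree is at most
   weight a, so the residue is the finite sum below. *)
Definition bilinear_identity (w wt : nat -> D) : Prop :=
  forall a : seq nat,
    \sum_(i < (weight a).+2) foldr dress (ser w) a (i%:Z - 1) * wtser wt i = 0.

Definition phi (w : nat -> D) : D := - w 1%N.
Definition ttheta (w : nat -> D) : D :=
  (2 : K)^-1 *: (d 0 (phi w) + phi w * phi w) - w 2%N.

Definition Fser (w : nat -> D) : nat -> D :=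
  fun n => lone n - lamhalf (dshift (phi w)) n.

Definition psi_shift (w : nat -> D) : nat -> int -> D :=
  fun n m => miwaT dress n (ser w) m.
Definition psi_l (w : nat -> D) : nat -> int -> D :=
  fun n m => if n == 0%N then ser w m else 0.

Definition Hser (w : nat -> D) : nat -> D :=
  fun n => dshift (ttheta w) n + (2 : K)^-1 *: d 0 (dshift (phi w) n)
           - (2 : K)^-1 *: (phi w * miwa n (phi w) - miwa n (phi w) * phi w).

(* left-hand side:  (1/lambda) F (psi_{2l} - psi) - (psi_{2l} + psi)_t1 ;
   division by lambda = shift of lambda-index (the lambda^0 coefficient of
   F (psi_{2l} - psi) vanishes) *)
Definition LHS31 (w : nat -> D) (n : nat) (m : int) : D :=
  lzmul (Fser w) (fun n' m' => psi_shift w n' m' - psi_l w n' m') n.+1 m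
  - dress 0 (fun m' => psi_shift w n m' + psi_l w n m') m.

Definition RHS31 (w : nat -> D) (n : nat) (m : int) : D :=
  lzmul (lmul (lamhalf (Hser w)) (linv (Fser w)))
        (fun n' m' => psi_shift w n' m' + psi_l w n' m') n m.

End Defs.

(* Main.v *)
(** Let E(lambda, z) e^xi be the difference of the two sides.  It is a
    left-linear combination of t-derivatives of psi, so the bilinear identity
    gives res (d^a (E e^xi) tilde psi) = 0 for all a; such an object vanishes
    as soon as its prefactor has no nonnegative powers of z.  Since psi_{2[lambda]}
    has the prefactor w_{2[lambda]} (1 + lambda z)/(1 - lambda z), the nonnegative
    powers of z in (1 - lambda z) E are confined to z^0, z^1 and z^2, and a direct
    computation shows that they cancel.  Hence, inductively in the order of lambda,
    E_n = (negative powers) + z E_{n-1} has only negative powers, and E_n = 0.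

    The Miwa shift M = exp (sum_k 2 lambda^(2k+1)/(2k+1) d_k) is handled through
    its Euler equation lambda M' = 2 sum_k lambda^(2k+1) d_k M, which determines
    it; multiplicativity and the factor (1 + lambda z)/(1 - lambda z) both follow
    from uniqueness. *)
Require Import Defs.
From HB Require Import structures.
From mathcomp Require Import all_boot all_order all_algebra.
From mathcomp Require Import zify ring.
Import GRing.Theory Num.Theory.
Local Open Scope ring_scope.

(** * Convolutions *)

Section Convolution.
Variable V : nmodType.

(** Both sides run over the triangle i + j <= n. *)
Lemma conv_exchange (A : nat -> nat -> V) n :
  \sum_(i < n.+1) \sum_(j < (n - i).+1) A i j =
  \sum_(j < n.+1) \sum_(i < (n - j).+1) A i j.
Proof.
have widen (B : nat -> nat -> V) :
    \sum_(i < n.+1) \sum_(j < (n - i).+1) B i j =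
    \sum_(i < n.+1) \sum_(j < n.+1 | (i + j <= n)%N) B i j.
  apply: eq_bigr => i _; rewrite (big_ord_widen n.+1); last by lia.
  by apply: eq_bigl => j; move: (ltn_ord i); lia.
rewrite widen (widen (fun j i => A i j)) (exchange_big_dep predT) //=.
by apply: eq_bigr => j _; apply: eq_bigl => i; rewrite addnC.
Qed.

(** Both sides run over the triples of indices with total n. *)
Lemma conv_assoc (A : nat -> nat -> nat -> V) n :
  \sum_(i < n.+1) \sum_(j < i.+1) A j (i - j)%N (n - i)%N =
  \sum_(j < n.+1) \sum_(i < (n - j).+1) A j i (n - j - i)%N.
Proof.
rewrite (reindex_inj rev_ord_inj) /=.
transitivity (\sum_(i < n.+1) \sum_(j < (n - i).+1) A j (n - i - j)%N i).
  apply: eq_bigr => i _; rewrite subSS; apply: eq_bigr => j _.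
  by congr A; move: (ltn_ord i); lia.
rewrite (conv_exchange (fun i j => A j (n - i - j)%N i)).
apply: eq_bigr => j _; rewrite (reindex_inj rev_ord_inj) /=.
apply: eq_bigr => i _; rewrite subSS.
by congr A; move: (ltn_ord i) (ltn_ord j); lia.
Qed.

(** The substitution i = 2k + 1 replaces the index of the time t_{2k+1} by the power of lambda, the
    form in which sums can be convolved. *)
Lemma sum_odd (F : nat -> V) n :
  \sum_(k < n.+1 | (2 * k + 1 <= n)%N) F k = \sum_(i < n.+1 | odd i) F i./2.
Proof.
transitivity (\sum_(k < n.+1./2) F k).
  rewrite (big_ord_widen n.+1); last by lia.
  by apply: eq_bigl => k; lia.
rewrite [RHS]big_mkcond; elim: n => [|n IHn].
  by rewrite big_ord0 big_ord_recr big_ord0 /= addr0.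
transitivity (\sum_(k < n.+1./2) F k + if odd n.+1 then F n.+1./2 else 0);
  last by rewrite IHn [RHS]big_ord_recr.
case: ifP => on.
  have -> : n.+2./2 = n.+1./2.+1 by lia.
  by rewrite big_ord_recr.
have -> : n.+2./2 = n.+1./2 by lia.
by rewrite addr0.
Qed.
End Convolution.

(** * The Miwa shift *)

Section MiwaOperator.
Variables (K : numFieldType) (D : algType K) (T : Type).
Variable dv : nat -> (T -> D) -> (T -> D).
(** [T] will be [unit] for plain elements and [int], the exponents of z, for dressed ones; [dv_ext]
    replaces functional extensionality. *)
Hypothesis dv_ext : forall k f g, f =1 g -> dv k f =1 dv k g.
Hypothesis dvD : forall k f g, dv k (fun x => f x + g x) =1 (fun x => dv k f x + dv k g x).
Hypothesis dvZ : forall k (c : K) f, dv k (fun x => c *: f x) =1 (fun x => c *: dv k f x).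
Hypothesis dvC : forall j k f, dv j (dv k f) =1 dv k (dv j f).

(* Half the coefficient of lambda^i in the Euler derivative of
   sum_k 2 lambda^(2k+1)/(2k+1) dv k. *)
Definition odd_der i (f : T -> D) x : D := if odd i then dv i./2 f x else 0.

Lemma odd_der_ext i f g : f =1 g -> odd_der i f =1 odd_der i g.
Proof. by move=> fg x; rewrite /odd_der; case: ifP => // _; apply: dv_ext. Qed.

Lemma odd_derZ i (c : K) f x : odd_der i (fun y => c *: f y) x = c *: odd_der i f x.
Proof. by rewrite /odd_der; case: ifP => _; rewrite ?dvZ ?scaler0. Qed.

Lemma odd_der0 i x : odd_der i (fun _ => 0) x = 0.
Proof.
have -> : odd_der i (fun _ => 0) x = odd_der i (fun y => 0 *: (0 : D)) x.
  by apply: odd_der_ext => y; rewrite scale0r.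
by rewrite (odd_derZ i 0 (fun _ => 0)) scale0r.
Qed.

Lemma odd_der_sum i (I : Type) (r : seq I) (P : pred I) (F : I -> T -> D) x :
  odd_der i (fun y => \sum_(j <- r | P j) F j y) x = \sum_(j <- r | P j) odd_der i (F j) x.
Proof.
elim: r => [|j r IHr].
  rewrite big_nil; apply: etrans (odd_der0 i x).
  by apply: odd_der_ext => y; rewrite big_nil.
rewrite big_cons -IHr; case: ifP => Pj; last first.
  by apply: odd_der_ext => y; rewrite big_cons Pj.
transitivity (odd_der i (fun y => F j y + \sum_(k <- r | P k) F k y) x).
  by apply: odd_der_ext => y; rewrite big_cons Pj.
by rewrite /odd_der; case: ifP => _; rewrite ?dvD ?addr0.
Qed.

Lemma odd_derC i j f x : odd_der i (odd_der j f) x = odd_der j (odd_der i f) x.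
Proof.
case oi: (odd i); case oj: (odd j).
- transitivity (dv i./2 (dv j./2 f) x).
    by rewrite /odd_der oi; apply: dv_ext => y; rewrite oj.
  rewrite dvC /odd_der oj; apply: dv_ext => y; by rewrite oi.
- rewrite [RHS]/odd_der oj; apply: etrans (odd_der0 i x).
  by apply: odd_der_ext => y; rewrite /odd_der oj.
- rewrite [LHS]/odd_der oi; apply: etrans (esym (odd_der0 j x)) _.
  by apply: odd_der_ext => y; rewrite /odd_der oi.
by rewrite /odd_der oi oj.
Qed.

Lemma stermS m n f x :
  sterm dv m.+1 n f x =
  \sum_(i < n.+1) (2 / i%:R : K) *: odd_der i (sterm dv m (n - i) f) x.
Proof.
rewrite /= (sum_odd _ (fun k => (2 / (2 * k + 1)%:R : K) *:
  dv k (sterm dv m (n - (2 * k + 1))%N f) x)) big_mkcond.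
apply: eq_bigr => i _; rewrite /odd_der; case: ifP => oi; last by rewrite scaler0.
by have -> : (2 * i./2 + 1 = i)%N by lia.
Qed.

(** L has no constant term in lambda, so L^m starts in order m. *)
Lemma sterm_small m n f x : (n < m)%N -> sterm dv m n f x = 0.
Proof.
elim: m n x => // m IHm n x ltnm; rewrite stermS big1 // => i _.
case: (posnP i) => [->|i0]; first by rewrite /odd_der /= scaler0.
have -> : odd_der i (sterm dv m (n - i) f) x = odd_der i (fun _ => 0) x.
  by apply: odd_der_ext => y; apply: IHm; move: (ltn_ord i); lia.
by rewrite odd_der0 scaler0.
Qed.

(* Euler's identity for lambda d/dlambda of L^m, with L the exponent of the Miwa shift. *)
Lemma sterm_euler m n f x :
  n%:R *: sterm dv m.+1 n f x =
  (m.+1%:R : K) *: \sum_(i < n.+1) (2 : K) *: odd_der i (sterm dv m (n - i) f) x.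
Proof.
elim: m n x => [|m IHm] n x.
  rewrite scale1r stermS scaler_sumr; apply: eq_bigr => i _.
  rewrite /odd_der; case: ifP => oi; last by rewrite !scaler0.
  rewrite scalerA; have [ni|ni] := eqVneq n i.
    by rewrite -ni mulrCA mulfV ?mulr1 // pnatr_eq0; lia.
  have z : dv i./2 (sterm dv 0 (n - i) f) x = 0.
    have := odd_der0 i x; rewrite /odd_der oi => <-; apply: dv_ext => y /=.
    by have -> : (n - i == 0)%N = false by move: ni (ltn_ord i); lia.
  by rewrite z !scaler0.
rewrite stermS scaler_sumr.
(* Product rule for lambda d/dlambda on L L^(m+1): the weight n splits as i + (n - i). *)
transitivity (\sum_(i < n.+1) (2 : K) *: odd_der i (sterm dv m.+1 (n - i) f) x +
   \sum_(i < n.+1) (2 / i%:R : K) *: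
      odd_der i (fun y => (n - i)%:R *: sterm dv m.+1 (n - i) f y) x).
  rewrite -big_split /=; apply: eq_bigr => i _.
  have -> : (n%:R : K) = i%:R + (n - i)%:R.
    by rewrite -natrD subnKC // -ltnS ltn_ord.
  rewrite odd_derZ !scalerA mulrDl scalerDl [(2 / _) * _]mulrC; congr (_ + _).
  rewrite /odd_der; case: ifP => oi; last by rewrite !scaler0.
  by rewrite mulrCA mulfV ?mulr1 // pnatr_eq0; lia.
rewrite -[m.+2%:R]natr1 addrC scalerDl scale1r; congr (_ + _).
transitivity (\sum_(i < n.+1) \sum_(j < (n - i).+1) (m.+1%:R * 2 * (2 / i%:R) : K) *:
     odd_der i (odd_der j (sterm dv m (n - i - j) f)) x).
  apply: eq_bigr => i _.
  rewrite (odd_der_ext i _ _ (IHm (n - i)%N)) odd_derZ odd_der_sum !scaler_sumr.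
  apply: eq_bigr => j _; rewrite odd_derZ !scalerA; congr (_ *: _); ring.
(* Exchanging the sums and commuting the two derivations reassembles L L^m into L^(m+1). *)
rewrite (conv_exchange _ (fun i j => (m.+1%:R * 2 * (2 / i%:R) : K) *:
     odd_der i (odd_der j (sterm dv m (n - i - j) f)) x)).
rewrite scaler_sumr; apply: eq_bigr => j _.
rewrite (odd_der_ext j _ _ (stermS m (n - j)%N f)) odd_der_sum !scaler_sumr.
apply: eq_bigr => i _; rewrite odd_derZ !scalerA odd_derC subnAC //.
Qed.

(** Summing the Euler identities of L^m / m! gives lambda M' = (lambda L') M. *)
Lemma miwaT_euler n f x :
  (n%:R : K) *: miwaT dv n f x = (2 : K) *: \sum_(i < n.+1) odd_der i (miwaT dv (n - i) f) x.
Proof.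
rewrite /miwaT big_ord_recl scalerDr.
have -> : (n%:R : K) *: ((0`!%:R : K)^-1 *: sterm dv 0 n f x) = 0.
  by case: n => [|n] /=; rewrite ?scale0r ?scaler0.
rewrite add0r !scaler_sumr.
transitivity (\sum_(m < n) \sum_(i < n.+1)
    ((m`!%:R)^-1 * 2 : K) *: odd_der i (sterm dv m (n - i) f) x).
  apply: eq_bigr => m _.
  rewrite lift0 scalerA mulrC -scalerA sterm_euler scalerA.
  have -> : (m.+1`!%:R^-1 * m.+1%:R : K) = m`!%:R^-1.
    rewrite factS natrM invfM mulrC mulrA mulfV ?mul1r //.
    by rewrite pnatr_eq0.
  by rewrite scaler_sumr; apply: eq_bigr => i _; rewrite scalerA.
rewrite exchange_big /=; apply: eq_bigr => i _.
rewrite odd_der_sum scaler_sumr.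
(* The ranges m < n and m <= n - i differ by terms with m > n - i, which vanish; i = 0 is treated
   apart because there the second range is the longer one. *)
case: (posnP i) => [->|i0].
  by rewrite !big1 // => m _; rewrite /odd_der /= ?scaler0.
pose F m := ((m`!%:R)^-1 * 2 : K) *: odd_der i (sterm dv m (n - i) f) x.
transitivity (\sum_(m < (n - i).+1) F m); last first.
  by apply: eq_bigr => m _; rewrite odd_derZ scalerA mulrC.
rewrite [RHS](big_ord_widen n F); last by move: (ltn_ord i); lia.
rewrite [RHS]big_mkcond; apply: eq_bigr => m _; rewrite {}/F.
case: ifP => // mi.
have -> : odd_der i (sterm dv m (n - i) f) x = odd_der i (fun _ => 0) x.
  by apply: odd_der_ext => y; apply: sterm_small; lia.
by rewrite odd_der0 scaler0.
Qed.

Lemma miwaT0 f x : miwaT dv 0 f x = f x.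
Proof. by rewrite /miwaT big_ord_recl big_ord0 /= addr0 invr1 scale1r. Qed.

(** Since [odd_der 0] vanishes, the recurrence expresses n X_n through lower coefficients, and n > 0
    is invertible in [K]. *)
Lemma miwaT_uniq f (X : nat -> T -> D) :
  X 0%N =1 f ->
  (forall n x, (n%:R : K) *: X n x = (2 : K) *: \sum_(i < n.+1) odd_der i (X (n - i)%N) x) ->
  forall n, X n =1 miwaT dv n f.
Proof.
move=> X0 XS; elim/ltn_ind => -[|n] IHn x; first by rewrite X0 miwaT0.
apply: (@scalerI _ _ (n.+1%:R : K)); first by rewrite pnatr_eq0.
rewrite XS miwaT_euler; congr (_ *: _); apply: eq_bigr => i _.
case: (posnP i) => [->|i0]; first by rewrite /odd_der.
by apply: odd_der_ext; apply: IHn; lia.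
Qed.

End MiwaOperator.

(** * Series in lambda *)

Section CauchyProduct.
Variables (K : numFieldType) (D : algType K).
Implicit Types a b c r : nat -> D.

Lemma lmulA a b c n : lmul (lmul a b) c n = lmul a (lmul b c) n.
Proof.
rewrite /lmul.
transitivity (\sum_(i < n.+1) \sum_(j < i.+1) a j * b (i - j)%N * c (n - i)%N).
  by apply: eq_bigr => i _; rewrite mulr_suml.
rewrite (conv_assoc _ (fun i j k => a i * b j * c k)).
by apply: eq_bigr => i _; rewrite mulr_sumr; apply: eq_bigr => j _; rewrite mulrA.
Qed.

Lemma lmul1 a n : lmul a (@lone K D) n = a n.
Proof.
rewrite /lmul big_ord_recr /= subnn mulr1 big1 ?add0r // => i _.
by rewrite /lone subn_eq0 leqNgt ltn_ord mulr0.
Qed.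

Lemma lmul1l a n : lmul (@lone K D) a n = a n.
Proof. by rewrite /lmul big_ord_recl /= mul1r subn0 big1 ?addr0 // => i _; rewrite mul0r. Qed.

Lemma eq_lmul a a' b b' n : a =1 a' -> b =1 b' -> lmul a b n = lmul a' b' n.
Proof. by move=> ea eb; apply: eq_bigr => i _; rewrite ea eb. Qed.

Lemma lpowSr r k n : lmul (lpow r k) r n = lpow r k.+1 n.
Proof.
elim: k n => [|k IHk] n; first by rewrite /lpow /= lmul1 lmul1l.
rewrite -[lpow r k.+2]/(lmul r (lpow r k.+1)) -[lpow r k.+1]/(lmul r (lpow r k)) lmulA.
by apply: eq_lmul.
Qed.

Lemma lpow_small r k n : r 0%N = 0 -> (n < k)%N -> lpow r k n = 0.
Proof.
move=> r0; elim: k n => // k IHk n ltnk; rewrite /lpow iterS /lmul big1 // => i _.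
case: (posnP i) => [->|i0]; first by rewrite r0 mul0r.
by rewrite -/(lpow r k) IHk ?mulr0 //; move: (ltn_ord i); lia.
Qed.

(** Telescoping: r^k (1 - r) = r^k - r^(k+1) with r = 1 - a, and r^(n+1) has no coefficient of order
    n. *)
Lemma lmulVf a n : a 0%N = 1 -> lmul (linv a) a n = lone D n.
Proof.
move=> a0; pose r i := lone D i - a i.
have r0 : r 0%N = 0 by rewrite /r a0 subrr.
(* The geometric sum may be cut at the common bound n, because r^k starts in order k. *)
have linvE i : (i <= n)%N -> linv a i = \sum_(k < n.+1) lpow r k i.
  move=> lein; rewrite /linv (big_ord_widen n.+1 (fun k => lpow r k i)) //.
  rewrite big_mkcond; apply: eq_bigr => k _; case: ifP => // kn.
  by rewrite lpow_small //; lia.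
transitivity (\sum_(k < n.+1) (lpow r k n - lpow r k.+1 n)).
  transitivity (\sum_(k < n.+1) lmul (lpow r k) a n).
    rewrite /lmul exchange_big /=; apply: eq_bigr => i _.
    by rewrite linvE ?mulr_suml // -ltnS.
  apply: eq_bigr => k _; rewrite -lpowSr -[X in _ = X - _]lmul1 -sumrB.
  by apply: eq_bigr => i _; rewrite -mulrBr /r subKr.
rewrite (eq_bigr (fun k : 'I_n.+1 => - (lpow r k.+1 n - lpow r k n))); last first.
  by move=> k _; rewrite opprB.
rewrite sumrN -(big_mkord predT (fun k => lpow r k.+1 n - lpow r k n)).
by rewrite telescope_sumr // opprB (lpow_small _ n.+1) // subr0.
Qed.

End CauchyProduct.

(** * The Miwa shift of plain and dressed objects *)

Section MiwaShift.
Variables (K : numFieldType) (D : algType K) (d : nat -> D -> D).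
Hypothesis dD : forall k (x y : D), d k (x + y) = d k x + d k y.
Hypothesis dZ : forall k (c : K) (x : D), d k (c *: x) = c *: d k x.
Hypothesis dM : forall k (x y : D), d k (x * y) = d k x * y + x * d k y.
Hypothesis dC : forall i j (x : D), d i (d j x) = d j (d i x).

Lemma der0 k : d k 0 = 0.
Proof. by have := dZ k 0 0; rewrite !scale0r. Qed.

Lemma der1 k : d k 1 = 0.
Proof. by apply: (addrI (d k 1)); have := dM k 1 1; rewrite !mulr1 mul1r addr0. Qed.

Lemma derN k x : d k (- x) = - d k x.
Proof. by rewrite -scaleN1r dZ scaleN1r. Qed.

Lemma derB k x y : d k (x - y) = d k x - d k y.
Proof. by rewrite dD derN. Qed.

Lemma der_sum k (I : Type) (r : seq I) (P : pred I) (F : I -> D) :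
  d k (\sum_(j <- r | P j) F j) = \sum_(j <- r | P j) d k (F j).
Proof. exact: (big_morph _ (dD k) (der0 k)). Qed.

Definition oder i (x : D) := if odd i then d i./2 x else 0.

Lemma oderD i x y : oder i (x + y) = oder i x + oder i y.
Proof. by rewrite /oder; case: ifP; rewrite ?addr0. Qed.

Lemma oderZ i (c : K) x : oder i (c *: x) = c *: oder i x.
Proof. by rewrite /oder; case: ifP; rewrite ?scaler0. Qed.

Lemma oderM i x y : oder i (x * y) = oder i x * y + x * oder i y.
Proof. by rewrite /oder; case: ifP; rewrite ?mulr0 ?mul0r ?addr0. Qed.

Lemma oder_sum i (I : Type) (r : seq I) (P : pred I) (F : I -> D) :
  oder i (\sum_(j <- r | P j) F j) = \sum_(j <- r | P j) oder i (F j).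
Proof. by rewrite /oder; case: ifP => _; [exact: der_sum | rewrite big1]. Qed.

Lemma oder_der i k x : oder i (d k x) = d k (oder i x).
Proof. by rewrite /oder; case: ifP => _; rewrite ?der0 // dC. Qed.

Lemma miwa_euler n f :
  (n%:R : K) *: miwa d n f = (2 : K) *: \sum_(i < n.+1) oder i (miwa d (n - i) f).
Proof.
rewrite /miwa (@miwaT_euler K D unit (fun k (g : unit -> D) u => d k (g u))) //.
- by move=> k f1 g fg x; rewrite fg.
- by move=> k f1 g x; apply: dD.
- by move=> k c f1 x; apply: dZ.
- by move=> j k f1 x; apply: dC.
Qed.

Lemma miwa0 f : miwa d 0 f = f.
Proof. exact: miwaT0. Qed.

Lemma miwa_uniq f (X : nat -> D) :
  X 0%N = f ->
  (forall n, (n%:R : K) *: X n = (2 : K) *: \sum_(i < n.+1) oder i (X (n - i)%N)) ->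
  forall n, X n = miwa d n f.
Proof.
move=> X0 XS n.
apply: (@miwaT_uniq K D unit (fun k (g : unit -> D) u => d k (g u)) _ _ _ _
  (fun=> f) (fun n _ => X n)) => //.
- by move=> k f1 g fg x; rewrite fg.
- by move=> k f1 g x; apply: dD.
- by move=> k c f1 x; apply: dZ.
- by move=> j k f1 x; apply: dC.
Qed.

Lemma miwaD n f g : miwa d n (f + g) = miwa d n f + miwa d n g.
Proof.
symmetry; apply: (@miwa_uniq _ (fun n => miwa d n f + miwa d n g)) => [|{}n].
  by rewrite !miwa0.
rewrite scalerDr !miwa_euler -scalerDr -big_split; congr (_ *: _).
by apply: eq_bigr => i _; rewrite oderD.
Qed.

Lemma miwaZ n (c : K) f : miwa d n (c *: f) = c *: miwa d n f.
Proof.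
symmetry; apply: (@miwa_uniq _ (fun n => c *: miwa d n f)) => [|{}n].
  by rewrite !miwa0.
rewrite scalerA mulrC -scalerA miwa_euler scalerA mulrC -scalerA scaler_sumr.
by congr (_ *: _); apply: eq_bigr => i _; rewrite oderZ.
Qed.

Lemma miwaN n f : miwa d n (- f) = - miwa d n f.
Proof. by rewrite -scaleN1r miwaZ scaleN1r. Qed.

Lemma miwa_der n k f : miwa d n (d k f) = d k (miwa d n f).
Proof.
symmetry; apply: (@miwa_uniq _ (fun n => d k (miwa d n f))) => [|{}n].
  by rewrite !miwa0.
rewrite -dZ miwa_euler dZ der_sum; congr (_ *: _).
by apply: eq_bigr => i _; rewrite oder_der.
Qed.

Lemma miwa_1 n : miwa d n 1 = lone D n.
Proof.
symmetry; apply: (@miwa_uniq _ (lone D)) => [//|{}n].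
rewrite big1 => [|i _]; last first.
  by rewrite /oder /lone; case: ifP => // _; case: ifP; rewrite ?der1 ?der0.
by case: n => [|n]; rewrite /lone /= ?scale0r !scaler0.
Qed.

Lemma miwa_0 n : miwa d n 0 = 0.
Proof. by have := miwaZ n 0 0; rewrite !scale0r. Qed.

(** The product of the shifts satisfies the Euler equation by two Leibniz rules, for lambda
    d/dlambda and for the derivations. *)
Lemma miwaM n f g :
  miwa d n (f * g) = lmul (fun i => miwa d i f) (fun i => miwa d i g) n.
Proof.
symmetry; apply: (miwa_uniq _ (lmul _ _)) => [|{}n].
  by rewrite /lmul big_ord_recl big_ord0 addr0 !miwa0.
transitivity ((2 : K) *: (\sum_(i < n.+1) \sum_(j < i.+1)
     oder j (miwa d (i - j) f) * miwa d (n - i) g +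
   \sum_(i < n.+1) \sum_(j < (n - i).+1) miwa d i f * oder j (miwa d (n - i - j) g))).
  rewrite /lmul scalerDr !scaler_sumr -big_split; apply: eq_bigr => i _ /=.
  have -> : (n%:R : K) = i%:R + (n - i)%:R.
    by rewrite -natrD subnKC // -ltnS ltn_ord.
  rewrite scalerDl scalerAl [X in _ + X = _]scalerAr !miwa_euler.
  by rewrite -scalerAl -scalerAr mulr_suml mulr_sumr.
(* Both double sums get the index j of the derivation outermost, so that the Leibniz rule can merge
   them. *)
rewrite (conv_assoc _ (fun j k l => oder j (miwa d k f) * miwa d l g)).
rewrite (conv_exchange _ (fun i j => miwa d i f * oder j (miwa d (n - i - j) g))).
rewrite -big_split; congr (_ *: _); apply: eq_bigr => j _ /=.
rewrite -big_split oder_sum; apply: eq_bigr => i _ /=.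
by rewrite oderM (subnAC _ i).
Qed.

Lemma dress_ext k (P Q : int -> D) : P =1 Q -> dress d k P =1 dress d k Q.
Proof. by move=> PQ m; rewrite /dress !PQ. Qed.

Lemma dressD k (P Q : int -> D) m :
  dress d k (fun m => P m + Q m) m = dress d k P m + dress d k Q m.
Proof. by rewrite /dress dD addrACA. Qed.

Lemma dressZ k (c : K) (P : int -> D) m :
  dress d k (fun m => c *: P m) m = c *: dress d k P m.
Proof. by rewrite /dress dZ scalerDr. Qed.

Lemma dressC j k (P : int -> D) m :
  dress d j (dress d k P) m = dress d k (dress d j P) m.
Proof. by rewrite /dress !dD dC -!addrA [- (2 * j + 1)%N%:Z + _]addrC [X in _ + X = _]addrCA. Qed.

Lemma sum_odd_nat n : \sum_(j < n) (odd j)%:R = (n./2)%:R :> K.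
Proof.
elim: n => [|n IHn]; first by rewrite big_ord0.
by rewrite big_ord_recr /= IHn -natrD uphalf_half addnC.
Qed.

(* The Taylor coefficients of (1 + x) / (1 - x). *)
Definition cayley (k : nat) : K := if k == 0%N then 1 else 2.

(* x g'(x) = 2 x / (1 - x^2) g(x) for g(x) = (1 + x) / (1 - x). *)
Lemma cayley_euler i :
  2 * \sum_(j < i.+1) (odd j)%:R * cayley (i - j) = i%:R * cayley i.
Proof.
case: i => [|i]; first by rewrite big_ord_recl big_ord0 /= !mul0r addr0 mulr0.
rewrite big_ord_recr /= subnn mulr1.
rewrite (eq_bigr (fun j : 'I_i.+1 => (odd j)%:R * 2)); last first.
  by move=> j _; rewrite /cayley subn_eq0 leqNgt ltn_ord.
rewrite -mulr_suml sum_odd_nat mulrC; congr (_ * _).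
rewrite -natrM -natrD; congr _%:R; lia.
Qed.

(* exp(xi(2[lambda], z)) = (1 + lambda z) / (1 - lambda z). *)
Lemma miwa_dress n (P : int -> D) m :
  miwaT (dress d) n P m = \sum_(k < n.+1) cayley k *: miwa d (n - k) (P (m - k%:Z)).
Proof.
pose X n m := \sum_(k < n.+1) cayley k *: miwa d (n - k) (P (m - k%:Z)).
symmetry; apply: (@miwaT_uniq K D int (dress d) _ _ _ _ P X) => {n m}.
- exact: dress_ext.
- by move=> k f g m; apply: dressD.
- by move=> k c f m; apply: dressZ.
- by move=> j k f m; apply: dressC.
- by move=> m; rewrite /X big_ord_recl big_ord0 addr0 miwa0 scale1r subr0.
move=> n m.
have oddE i (Y : int -> D) :
    odd_der K D int (dress d) i Y m = oder i (Y m) + (odd i)%:R *: Y (m - i%:Z).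
  rewrite /odd_der /oder; case: ifP => oi; last by rewrite scale0r addr0.
  rewrite /dress scale1r; congr (_ + Y (_ - _)).
  by have -> : (2 * i./2 + 1 = i)%N by lia.
transitivity (\sum_(k < n.+1) (k%:R * cayley k) *: miwa d (n - k) (P (m - k%:Z)) +
   \sum_(k < n.+1) \sum_(i < (n - k).+1)
     (2 * cayley k) *: oder i (miwa d (n - k - i) (P (m - k%:Z)))).
  rewrite /X scaler_sumr -big_split; apply: eq_bigr => k _ /=.
  have -> : (n%:R : K) = k%:R + (n - k)%:R.
    by rewrite -natrD subnKC // -ltnS ltn_ord.
  rewrite scalerDl scalerA; congr (_ + _).
  rewrite scalerA mulrC -scalerA miwa_euler scalerA mulrC scaler_sumr.
  by apply: eq_bigr.
under [in RHS]eq_bigr => i _ do rewrite oddE.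
rewrite big_split scalerDr addrC; congr (_ + _).
  rewrite (conv_exchange _ (fun k i => (2 * cayley k) *:
     oder i (miwa d (n - k - i) (P (m - k%:Z))))).
  rewrite scaler_sumr; apply: eq_bigr => i _; rewrite /X oder_sum scaler_sumr.
  by apply: eq_bigr => k _; rewrite oderZ scalerA subnAC.
(* The terms z^i coming from the exponential are grouped by the total exponent i + k, which produces
   the convolution in [cayley_euler]. *)
transitivity ((2 : K) *: \sum_(i < n.+1) \sum_(k < (n - i).+1)
    ((odd i)%:R * cayley k) *: miwa d (n - i - k) (P (m - (i + k)%N%:Z))); last first.
  congr (_ *: _); apply: eq_bigr => i _; rewrite /X scaler_sumr.
  by apply: eq_bigr => k _; rewrite scalerA PoszD opprD addrA.
rewrite -(conv_assoc _ (fun i k l =>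
    ((odd i)%:R * cayley k) *: miwa d l (P (m - (i + k)%N%:Z)))).
rewrite scaler_sumr; apply: eq_bigr => i _.
rewrite -cayley_euler mulr_sumr scaler_suml scaler_sumr; apply: eq_bigr => j _.
by rewrite scalerA subnKC // -ltnS ltn_ord.
Qed.

End MiwaShift.

(** * Consequences of the bilinear identity *)

Section Annihilator.
Variables (K : numFieldType) (D : algType K) (d : nat -> D -> D) (wt : nat -> D).
Hypothesis dD : forall k (x y : D), d k (x + y) = d k x + d k y.
Hypothesis dZ : forall k (c : K) (x : D), d k (c *: x) = c *: d k x.
Hypothesis dM : forall k (x y : D), d k (x * y) = d k x * y + x * d k y.
Implicit Types P Q : int -> D.

(* [P e^xi] pairs to zero with tilde psi, together with all its derivatives;
   "for all large B" avoids recording a bound on the z-degree of P. *)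
Definition annihilates P : Prop :=
  forall a : seq nat, exists B0, forall B, (B0 <= B)%N ->
    \sum_(i < B) foldr (dress d) P a (i%:Z - 1) * wtser wt i = 0.

Lemma foldr_dress_ext a P Q : P =1 Q -> foldr (dress d) P a =1 foldr (dress d) Q a.
Proof. by move=> PQ; elim: a => //= k a IHa m; apply: dress_ext. Qed.

Lemma foldr_dressD a P Q m :
  foldr (dress d) (fun m => P m + Q m) a m =
  foldr (dress d) P a m + foldr (dress d) Q a m.
Proof.
elim: a m => //= k a IHa m.
by rewrite (dress_ext _ _ _ _ _ _ IHa) dressD.
Qed.

Lemma annihilates_ext P Q : P =1 Q -> annihilates P -> annihilates Q.
Proof.
move=> PQ annP a; have [B0 H] := annP a; exists B0 => B /H; apply: etrans.
by apply: eq_bigr => i _; rewrite (foldr_dress_ext a _ _ PQ).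
Qed.

Lemma annihilatesD P Q :
  annihilates P -> annihilates Q -> annihilates (fun m => P m + Q m).
Proof.
move=> annP annQ a; have [B1 H1] := annP a; have [B2 H2] := annQ a.
exists (maxn B1 B2) => B; rewrite geq_max => /andP[le1 le2].
under eq_bigr do rewrite foldr_dressD mulrDl.
by rewrite big_split /= H1 // H2 // addr0.
Qed.

Lemma annihilates_dress k P : annihilates P -> annihilates (dress d k P).
Proof.
move=> annP a; have [B0 H] := annP (rcons a k); exists B0 => B /H; apply: etrans.
by rewrite foldr_rcons.
Qed.

(** The coefficient x need not be constant: the dressed derivative of x P is (d_k x) P plus x times
    that of P, and both have fewer derivations left to apply. *)
Lemma annihilatesM x P : annihilates P -> annihilates (fun m => x * P m).
Proof.
(* [foldr] applies the last derivation first, so the list is taken apart at its end. *)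
move=> annP a; elim/last_ind: a x P annP => [|a k IHa] x P annP.
  have [B0 H] := annP [::]; exists B0 => B /H /= H1.
  under eq_bigr do rewrite -mulrA.
  by rewrite -mulr_sumr H1 mulr0.
have [B1 H1] := IHa (d k x) P annP.
have [B2 H2] := IHa x _ (annihilates_dress k P annP).
exists (maxn B1 B2) => B; rewrite geq_max => /andP[le1 le2].
transitivity (\sum_(i < B) (foldr (dress d) (fun m => d k x * P m) a (i%:Z - 1) * wtser wt i
   + foldr (dress d) (fun m => x * dress d k P m) a (i%:Z - 1) * wtser wt i)).
  apply: eq_bigr => i _; rewrite foldr_rcons -mulrDl -foldr_dressD.
  congr (_ * _); apply: foldr_dress_ext => m.
  by rewrite /dress dM mulrDr addrA.
by rewrite big_split /= H1 // H2 // addr0.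
Qed.

Lemma annihilatesZ (c : K) P : annihilates P -> annihilates (fun m => c *: P m).
Proof.
move/(annihilatesM c%:A); apply: annihilates_ext => m.
by rewrite mulr_algl.
Qed.

Lemma annihilates0 : annihilates (fun=> 0).
Proof.
move=> a; exists 0%N => B _; rewrite big1 // => i _.
have -> : foldr (dress d) (fun=> 0) a (i%:Z - 1) = 0; last by rewrite mul0r.
by elim: a (_ - _) => //= k a IHa m; rewrite /dress !IHa addr0 (der0 K D d dZ).
Qed.

Lemma annihilatesN P : annihilates P -> annihilates (fun m => - P m).
Proof. by move/(annihilatesZ (-1)); apply: annihilates_ext => m; rewrite scaleN1r. Qed.

Lemma annihilates_sum (I : Type) (r : seq I) (p : pred I) (F : I -> int -> D) :
  (forall i, p i -> annihilates (F i)) -> annihilates (fun m => \sum_(i <- r | p i) F i m).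
Proof.
move=> annF; elim: r => [|i r IHr].
  by apply: annihilates_ext annihilates0 => m; rewrite big_nil.
case pi: (p i).
  apply: annihilates_ext (annihilatesD _ _ (annF i pi) IHr) => m.
  by rewrite big_cons pi.
by apply: annihilates_ext IHr => m; rewrite big_cons pi.
Qed.

Lemma annihilates_miwaT n P : annihilates P -> annihilates (miwaT (dress d) n P).
Proof.
move=> annP; apply: annihilates_sum => m _; apply: annihilatesZ.
move: (nat_of_ord m) => {}m; elim: m n => [|m IHm] n.
  by rewrite /=; case: eqP => // _; apply: annihilates0.
by apply: annihilates_sum => k _; apply/annihilatesZ/annihilates_dress/IHm.
Qed.

(** Each [dress d k] raises the degree in z by at most 2k + 1. *)
Lemma foldr_dress_ser_high (w : nat -> D) a m :
  (weight a)%:Z < m -> foldr (dress d) (ser w) a m = 0.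
Proof.
elim: a m => [|k a IHa] m; first by case: m => [[|m]|m].
rewrite /weight /= -/(weight a) => ltm.
by rewrite /dress !IHa ?(der0 K D d dZ) ?addr0 //; lia.
Qed.

Lemma annihilates_ser (w : nat -> D) : bilinear_identity d w wt -> annihilates (ser w).
Proof.
move=> bil a; exists (weight a).+2 => B leB; rewrite -(subnKC leB) big_split_ord /=.
rewrite [X in X + _](bil a) add0r big1 // => i _.
by rewrite foldr_dress_ser_high ?mul0r //; lia.
Qed.

(* The residue of a series without nonnegative powers of z is its first
   coefficient, and d/dt_1 shifts the next coefficient into that position. *)
Lemma annihilates_negative P :
  annihilates P -> (forall m : int, 0 <= m -> P m = 0) -> forall m, P m = 0.
Proof.
have res1 Q : annihilates Q -> (forall m : int, 0 <= m -> Q m = 0) -> Q (-1) = 0.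
  move=> annQ Q0; have [B0 /(_ B0.+1 (leqnSn _))] := annQ [::].
  rewrite big_ord_recl /= mulr1 big1 ?addr0 // => i _.
  by rewrite Q0 ?mul0r // lift0; lia.
move=> annP P0; suff neg j : P (Negz j) = 0 by case=> m; rewrite ?neg ?P0.
elim: j P annP P0 => [|j IHj] P annP P0; first exact: res1.
(* The derivative brings P(-1) to z^0, and P(-1) is a vanishing residue. *)
have dP0 m : 0 <= m -> dress d 0 P m = 0.
  move=> m0; rewrite /dress P0 // (der0 K D d dZ) add0r.
  have [->|m1] := eqVneq m 0; first exact: res1.
  by rewrite P0 //; lia.
have := IHj _ (annihilates_dress 0 P annP) dP0.
rewrite /dress IHj // (der0 K D d dZ) add0r => <-.
by congr P; lia.
Qed.

End Annihilator.

(** * Cancellation of the nonnegative powers of z *)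

Section DarbouxIdentity.
Variables (K : numFieldType) (D : algType K) (d : nat -> D -> D) (w wt : nat -> D).
Hypothesis dD : forall k (x y : D), d k (x + y) = d k x + d k y.
Hypothesis dZ : forall k (c : K) (x : D), d k (c *: x) = c *: d k x.
Hypothesis dM : forall k (x y : D), d k (x * y) = d k x * y + x * d k y.
Hypothesis dC : forall i j (x : D), d i (d j x) = d j (d i x).

(* Multiplication by 1 - lambda z. *)
Definition mul1mlz (c : nat -> int -> D) (n : nat) (m : int) : D :=
  c n m - (if n is p.+1 then c p (m - 1) else 0).

Lemma mul1mlzD b c n m :
  mul1mlz (fun n m => b n m + c n m) n m = mul1mlz b n m + mul1mlz c n m.
Proof. by case: n => [|n]; rewrite /mul1mlz ?subr0 // opprD addrACA. Qed.

Lemma mul1mlzB b c n m :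
  mul1mlz (fun n m => b n m - c n m) n m = mul1mlz b n m - mul1mlz c n m.
Proof. by case: n => [|n]; rewrite /mul1mlz ?subr0 // !opprD addrACA. Qed.

Lemma mul1mlz_lzmul a c n m :
  mul1mlz (lzmul a c) n m = lzmul a (mul1mlz c) n m.
Proof.
case: n => [|n]; rewrite /mul1mlz /lzmul.
  by rewrite subr0; apply: eq_bigr => i _; case: i => -[|i] //= _; rewrite subr0.
rewrite big_ord_recr [in RHS]big_ord_recr /= subnn subr0 addrAC; congr (_ + _).
rewrite -sumrB; apply: eq_bigr => i _.
by rewrite subSn -?mulrBr // -ltnS ltn_ord.
Qed.

(** * Coefficients of (1 - lambda z)(psi_{2[lambda]} - psi) and (1 - lambda z)(psi_{2[lambda]} +
    psi) *)

Notation shift := (miwa d).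
Notation U := (fun n m => psi_shift d w n m - psi_l w n m).
Notation V := (fun n m => psi_shift d w n m + psi_l w n m).

(** The factor 1 - lambda z clears the denominator and leaves (1 + lambda z) w_{2[lambda]}. *)
Lemma mul1mlz_psi_shift n m :
  mul1mlz (psi_shift d w) n m =
  shift n (ser w m) + (if n is p.+1 then shift p (ser w (m - 1)) else 0).
Proof.
have psiE k l := miwa_dress K D d dD dZ dC k (ser w) l.
case: n => [|n]; rewrite /mul1mlz /psi_shift !psiE.
  by rewrite big_ord_recl big_ord0 scale1r !subr0.
rewrite big_ord_recl /= scale1r subr0 -addrA; congr (_ + _).
(* Consecutive [cayley] coefficients are equal and cancel, except the first two, whose difference is
   2 - 1. *)
rewrite -sumrB big_ord_recl /= big1 ?addr0 => [|i _].
  by rewrite -[bump 0 0]/1%N subn1 subn0 scale1r scaler_nat mulr2n addrK.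
rewrite -[bump 0 (bump 0 i)]/i.+2 -[bump 0 i]/i.+1 subSS.
by have -> : m - i.+2%:Z = m - 1 - i.+1%:Z; [lia | rewrite subrr].
Qed.

Lemma mul1mlz_psi_l n m :
  mul1mlz (psi_l w) n m =
  match n with 0%N => ser w m | 1%N => - ser w (m - 1) | _ => 0 end.
Proof. by case: n => [|[|n]]; rewrite /mul1mlz /psi_l /= ?subr0 ?sub0r. Qed.

Lemma shift_ser_neg1 n : shift n (ser w (-1)) = - shift n (phi w).
Proof. by rewrite /phi miwaN // opprK. Qed.

Definition at0 (x : D) (n : nat) : D := if n == 0%N then x else 0.

(** The source of F: the z^0 coefficient of (1 + lambda z) w_{2[lambda]} + (1 - lambda z) w is 2 -
    lambda (phi_{2[lambda]} - phi). *)
Lemma mul1mlz_add_0 n : mul1mlz V n 0 = (2 : K) *: Fser d w n.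
Proof.
rewrite mul1mlzD mul1mlz_psi_shift mul1mlz_psi_l /Fser.
case: n => [|n]; first by rewrite miwa0 addr0 /lone /lamhalf /= subr0 scaler_nat.
rewrite shift_ser_neg1 miwa_1 // /lone /lamhalf /= !sub0r scalerN.
rewrite scalerA mulfV ?scale1r; last first.
  by rewrite pnatr_eq0.
rewrite /dshift opprB; case: n => [|n] /=; last by rewrite addr0 sub0r.
by rewrite addrC.
Qed.

(** At z^1 the contributions lambda and -lambda cancel; higher powers do not occur. *)
Lemma mul1mlz_add_pos n k : mul1mlz V n k.+1 = 0.
Proof.
rewrite mul1mlzD mul1mlz_psi_shift mul1mlz_psi_l.
have -> : k.+1%:Z - 1 = k by lia.
have s0 j : shift j (ser w k.+1) = 0 by rewrite /= miwa_0.
case: n => [|n]; rewrite s0 ?addr0 // add0r.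
case: k {s0} => [|k] /=; last by rewrite miwa_0 // add0r; case: n; rewrite // oppr0.
by rewrite miwa_1 // /lone; case: n => [|n] /=; rewrite ?subrr ?addr0.
Qed.

Lemma mul1mlz_sub_0 n : mul1mlz U n 0 =
  if n is p.+1 then - (shift p (phi w) + at0 (phi w) p) else 0.
Proof.
rewrite mul1mlzB mul1mlz_psi_shift mul1mlz_psi_l.
case: n => [|n]; first by rewrite miwa0 addr0 subrr.
rewrite shift_ser_neg1 miwa_1 // add0r opprD /at0; congr (_ + _).
by case: n => [|n] //=; rewrite ?oppr0 ?opprK.
Qed.

Lemma mul1mlz_sub_1 n : mul1mlz U n 1 = if n is p.+1 then (2 : K) *: lone D p else 0.
Proof.
rewrite mul1mlzB mul1mlz_psi_shift mul1mlz_psi_l.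
case: n => [|n]; first by rewrite miwa0 /= addr0 subrr.
rewrite /= miwa_0 // miwa_1 // add0r scaler_nat mulr2n; congr (_ + _).
by case: n => [|n]; rewrite /lone /= ?opprK ?oppr0.
Qed.

Lemma mul1mlz_sub_high n k : mul1mlz U n k.+2 = 0.
Proof.
rewrite mul1mlzB mul1mlz_psi_shift mul1mlz_psi_l.
have -> : k.+2%:Z - 1 = k.+1 by lia.
by case: n => [|[|n]] /=; rewrite !miwa_0 // ?addr0 ?subr0 ?opprK ?addr0.
Qed.

(** Prepares the division by lambda: the separated term contains the order-0 part of [U], which is
    zero because psi_{2[lambda]} = psi at lambda = 0. *)
Lemma lzmul_mul1mlz_sub n m :
  lzmul (Fser d w) (mul1mlz U) n.+1 m =
  \sum_(i < n.+1) Fser d w i * mul1mlz U (n - i).+1 m + Fser d w n.+1 * mul1mlz U 0 m.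
Proof.
rewrite /lzmul big_ord_recr /= subnn; congr (_ + _).
by apply: eq_bigr => i _; rewrite subSn // -ltnS ltn_ord.
Qed.

(** * The two sides after multiplication by 1 - lambda z *)

Lemma mul1mlz_dress (c : nat -> int -> D) n m :
  mul1mlz (fun n => dress d 0 (c n)) n m = d 0 (mul1mlz c n m) + mul1mlz c n (m - 1).
Proof.
have shift1 l : l - (2 * 0 + 1)%N%:Z = l - 1 by [].
case: n => [|n]; rewrite /mul1mlz /dress !shift1 ?subr0 //.
by rewrite (derB K D d dD dZ) opprD addrACA.
Qed.

Lemma mul1mlz_LHS n m :
  mul1mlz (LHS31 d w) n m =
  lzmul (Fser d w) (mul1mlz U) n.+1 m
  - (d 0 (mul1mlz V n m) + mul1mlz V n (m - 1)).
Proof.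
rewrite -mul1mlz_dress /LHS31 mul1mlzB -mul1mlz_lzmul; congr (_ - _).
(* Lowering the lambda-index commutes with 1 - lambda z except in order 0, where the extra term is
   the lambda^0 coefficient of the product, equal to zero. *)
case: n => [|n] //; rewrite /mul1mlz; congr (_ - _).
rewrite /lzmul big_ord_recl big_ord0 addr0 subn0 /psi_shift miwaT0 /psi_l.
by rewrite subrr mulr0.
Qed.

(** Here F^(-1) cancels against the z^0 coefficient 2 F. *)
Lemma mul1mlz_RHS_0 n : mul1mlz (RHS31 d w) n 0 = (2 : K) *: lamhalf (Hser d w) n.
Proof.
rewrite mul1mlz_lzmul.
transitivity ((2 : K) *: lmul (lmul (lamhalf (Hser d w)) (linv (Fser d w))) (Fser d w) n).
  rewrite /lmul scaler_sumr; apply: eq_bigr => i _.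
  by rewrite mul1mlz_add_0 -scalerAr.
rewrite lmulA -[in RHS](lmul1 K D (lamhalf _)); congr (_ *: _).
apply: eq_lmul => // i; apply: lmulVf.
by rewrite /Fser /lone /lamhalf /= subr0.
Qed.

Lemma mul1mlz_RHS_pos n k : mul1mlz (RHS31 d w) n k.+1 = 0.
Proof. by rewrite mul1mlz_lzmul /lzmul big1 // => i _; rewrite mul1mlz_add_pos mulr0. Qed.

(** The source of the commutator: (y - phi)(y + phi) = y^2 - phi^2 + [y, phi], where y^2 is the
    shift of phi^2. *)
Lemma lmul_dshift_phi n (y := fun n => shift n (phi w)) :
  lmul (dshift d (phi w)) (fun n => y n + at0 (phi w) n) n =
  dshift d (phi w * phi w) n + (y n * phi w - phi w * y n).
Proof.
rewrite /lmul /dshift miwaM // -/y.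
transitivity (lmul y y n + lmul y (at0 (phi w)) n
   - (lmul (at0 (phi w)) y n + lmul (at0 (phi w)) (at0 (phi w)) n)).
  rewrite /lmul -!big_split -sumrB; apply: eq_bigr => i _ /=.
  by rewrite -mulrDr -mulrDr -mulrBl.
have at0l b : lmul (at0 (phi w)) b n = phi w * b n.
  by rewrite /lmul big_ord_recl /= subn0 big1 ?addr0 // => i _; rewrite mul0r.
have at0r : lmul y (at0 (phi w)) n = y n * phi w.
  rewrite /lmul big_ord_recr /= subnn big1 ?add0r // => i _.
  by rewrite /at0 subn_eq0 leqNgt ltn_ord mulr0.
rewrite !at0l at0r -/(lmul y y n) opprD addrACA -addrA addrC.
have -> : phi w * at0 (phi w) n = if n == 0%N then phi w * phi w else 0.
  by rewrite /at0; case: ifP; rewrite ?mulr0.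
rewrite [LHS]addrC -[RHS]addrA; congr (_ + _).
by rewrite addrCA [RHS]addrCA; congr (_ + _); rewrite addrC.
Qed.

Lemma w2E : w 2%N = (2 : K)^-1 *: (d 0 (phi w) + phi w * phi w) - ttheta d w.
Proof. by rewrite /ttheta subKr. Qed.

Lemma dshiftD n x y : dshift d (x + y) n = dshift d x n + dshift d y n.
Proof. by rewrite /dshift miwaD //; case: ifP; rewrite ?subr0 // opprD addrACA. Qed.

Lemma dshiftZ n (c : K) x : dshift d (c *: x) n = c *: dshift d x n.
Proof. by rewrite /dshift miwaZ // scalerBr; case: ifP; rewrite ?scaler0. Qed.

Lemma dshift_der n k x : dshift d (d k x) n = d k (dshift d x n).
Proof.
rewrite /dshift (derB K D d dD dZ) miwa_der //.
by case: ifP; rewrite ?(der0 K D d dZ).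
Qed.

Lemma dshift_w2 n : dshift d (w 2%N) n =
  (2 : K)^-1 *: d 0 (dshift d (phi w) n) + (2 : K)^-1 *: dshift d (phi w * phi w) n
  - dshift d (ttheta d w) n.
Proof.
by rewrite w2E -scaleN1r dshiftD !dshiftZ dshiftD scalerDr dshift_der scaleN1r.
Qed.

(** Needed because d/dt_1 of a dressed object moves the z^(-1) coefficient to z^0; this is how w_2,
    hence [ttheta], enters. *)
Lemma mul1mlz_add_neg1 n : mul1mlz V n (-1) =
  if n is p.+1 then - shift p.+1 (phi w) + dshift d (w 2%N) p else - (phi w + phi w).
Proof.
rewrite mul1mlzD mul1mlz_psi_shift mul1mlz_psi_l shift_ser_neg1.
case: n => [|n]; first by rewrite miwa0 addr0 opprD /phi !opprK.
rewrite -addrA; congr (_ + _); rewrite /dshift; congr (_ + _).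
by case: n => [|n] //=; rewrite oppr0.
Qed.

Lemma FserS n : Fser d w n.+1 = - ((2 : K)^-1 *: dshift d (phi w) n).
Proof. by rewrite /Fser /lone sub0r. Qed.

Lemma scale2V (x : D) : (2 : K) *: ((2 : K)^-1 *: x) = x.
Proof. by rewrite scalerA mulfV ?scale1r // pnatr_eq0. Qed.

Lemma lzmul_mul1mlz_sub_0 n (y := fun n => shift n (phi w)) :
  lzmul (Fser d w) (mul1mlz U) n.+1 0 = - lmul (Fser d w) (fun n => y n + at0 (phi w) n) n.
Proof.
rewrite lzmul_mul1mlz_sub (mul1mlz_sub_0 0) mulr0 addr0 /lmul -sumrN; apply: eq_bigr => i _.
by rewrite mul1mlz_sub_0 mulrN.
Qed.

(** In the application y is the shift of phi in order n + 1, t the shift difference of [ttheta], and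
    q, r, e are the halves of the shift difference of phi^2, of [phi_{2[lambda]}, phi] and of
    (phi_{2[lambda]} - phi)_{t_1} in order n. *)
Lemma zmod_cancel (A : zmodType) (y q r e t : A) :
  - (y - (q + r)) - (- (e + e) + (- y + (e + q - t))) = t + e - - r.
Proof.
rewrite !(opprD, opprK) !addrA [LHS](ACl ((1*6)*(2*8)*(4*7)*9*5*3)) /=.
by rewrite addNr !subrr !add0r.
Qed.

Lemma mul1mlz_LHS_0 n : mul1mlz (LHS31 d w) n 0 = (2 : K) *: lamhalf (Hser d w) n.
Proof.
rewrite mul1mlz_LHS mul1mlz_add_0 mul1mlz_add_neg1 lzmul_mul1mlz_sub_0; case: n => [|n].
  rewrite /lmul big_ord_recl big_ord0 addr0 /Fser /lone /lamhalf /= !subr0 miwa0 mul1r.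
  by rewrite dZ (der1 K D d dM) !scaler0 add0r subrr.
have FY Y : lmul (Fser d w) Y n.+1 =
    Y n.+1 - (2 : K)^-1 *: lmul (dshift d (phi w)) Y n.
  rewrite /lmul big_ord_recl /Fser /lone /lamhalf /= !subr0 mul1r; congr (_ + _).
  rewrite scaler_sumr -sumrN; apply: eq_bigr => i _.
  by rewrite -[bump 0 i]/i.+1 subSS sub0r mulNr scalerAl.
rewrite FY lmul_dshift_phi FserS scalerN scale2V /lamhalf /= scale2V /at0 /= addr0.
rewrite dshift_w2 (derN K D d dZ) /Hser -/(dshift d (phi w) n).
rewrite scalerDr -[phi w * shift n _ - _]opprB scalerN.
have := zmod_cancel D (shift n.+1 (phi w)) ((2 : K)^-1 *: dshift d (phi w * phi w) n)
  ((2 : K)^-1 *: (shift n (phi w) * phi w - phi w * shift n (phi w)))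
  ((2 : K)^-1 *: d 0 (dshift d (phi w) n)) (dshift d (ttheta d w) n).
by rewrite -(mulr2n (2^-1 *: d 0 _)) -scaler_nat scale2V.
Qed.

(** At z^1 the product of F / lambda with 2 lambda cancels the z^0 coefficient 2 F moved up by
    d/dt_1; beyond z^1 every contribution is zero. *)
Lemma mul1mlz_LHS_pos n k : mul1mlz (LHS31 d w) n k.+1 = 0.
Proof.
rewrite mul1mlz_LHS mul1mlz_add_pos (der0 K D d dZ) add0r lzmul_mul1mlz_sub.
have -> : k.+1%:Z - 1 = k by lia.
case: k => [|k]; last first.
  by rewrite mul1mlz_add_pos subr0 mul1mlz_sub_high mulr0 addr0 big1 // => i _; rewrite mul1mlz_sub_high mulr0.
rewrite (mul1mlz_sub_1 0) mulr0 addr0 mul1mlz_add_0; apply/eqP; rewrite subr_eq0; apply/eqP.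
rewrite -[in RHS](lmul1 K D (Fser d w)) /lmul scaler_sumr; apply: eq_bigr => i _.
by rewrite mul1mlz_sub_1 -scalerAr.
Qed.

(** * The difference of the two sides *)

Lemma annihilates_defect n : bilinear_identity d w wt ->
  annihilates K D d wt (fun m => LHS31 d w n m - RHS31 d w n m).
Proof.
move=> bil; have annw := annihilates_ser K D d wt dZ w bil.
have annV k : annihilates K D d wt (psi_shift d w k).
  exact: annihilates_miwaT.
have annl k : annihilates K D d wt (psi_l w k).
  by case: k => [//|k]; apply: annihilates0.
have annN P : annihilates K D d wt P -> annihilates K D d wt (fun m => - P m).
  exact: annihilatesN.
do !apply: annihilatesD => //.
- apply: annihilates_sum => // i _; apply: annihilatesM => //.
  by apply: annihilatesD => //; apply: annN.
- by apply: annN; apply: annihilates_dress; apply: annihilatesD.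
apply: annN; apply: annihilates_sum => // i _; apply: annihilatesM => //.
exact: annihilatesD.
Qed.

Lemma mul1mlz_defect n (m : int) : 0 <= m ->
  mul1mlz (fun n m => LHS31 d w n m - RHS31 d w n m) n m = 0.
Proof.
rewrite mul1mlzB; case: m => [[|k]|//] _.
  by rewrite mul1mlz_LHS_0 mul1mlz_RHS_0 subrr.
by rewrite mul1mlz_LHS_pos mul1mlz_RHS_pos subrr.
Qed.

End DarbouxIdentity.

Theorem theorem3p1 (K : numFieldType) (D : algType K) (d : nat -> D -> D)
    (w wt : nat -> D)
    (dD : forall k (x y : D), d k (x + y) = d k x + d k y)
    (dZ : forall k (c : K) (x : D), d k (c *: x) = c *: d k x)
    (dM : forall k (x y : D), d k (x * y) = d k x * y + x * d k y)
    (dC : forall i j (x : D), d i (d j x) = d j (d i x))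
    (hbil : bilinear_identity d w wt) :
  forall (n : nat) (m : int), LHS31 d w n m = RHS31 d w n m.
Proof.
suff defect0 n : forall m, LHS31 d w n m - RHS31 d w n m = 0.
  by move=> n m; apply/eqP; rewrite -subr_eq0 defect0.
elim: n => [|n IHn]; apply: (@annihilates_negative K D d wt) => //;
  try exact: annihilates_defect.
  by move=> m /(mul1mlz_defect K D d w dD dZ dM dC 0); rewrite /mul1mlz subr0.
(* The subtracted multiple of z is the defect in order n, zero by induction, so the defect in order
   n + 1 itself has no nonnegative powers. *)
by move=> m /(mul1mlz_defect K D d w dD dZ dM dC n.+1); rewrite /mul1mlz IHn subr0.
Qed.
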